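(* For every $c>0$ there exists $c'>0$, depending only on $c$, such that for every odd prime power $q$ and all sets $E,F\subset\mathbb F_q^2$ with $|E||F|\ge c\,q^{8/3}$, one has $$|\Delta(E,F)|=\big|\{\|x-y\|_2\in\mathbb F_q: x\in E,\ y\in F\}\big|\ge c' q .$$ That is, if $|E||F|\gtrsim q^{8/3}$ then $|\Delta(E,F)|\gtrsim q$.
   Context: $\mathbb F_q$ is the finite field with $q$ elements. For $x=(x_1,x_2)\in\mathbb F_q^2$, $\|x\|_2=x_1^2+x_2^2\in\mathbb F_q$. $\Delta(E,F)=\{\|x-y\|_2: x\in E,y\in F\}\subset\mathbb F_q$. $X\lesssim Y$ (equivalently $Y\gtrsim X$) means $X\le CY$ for a constant $C>0$ independent of $q$. *)

(* Defs.v *)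
From mathcomp Require Import all_boot all_order all_algebra.

Set Implicit Arguments.
Unset Strict Implicit.
Unset Printing Implicit Defensive.

Import GRing.Theory.

Local Open Scope ring_scope.

(* Not a norm in the metric sense: it takes values in K, with no square root. *)
Definition norm2 (K : finFieldType) (x : 'rV[K]_2) : K :=
  x 0 0 ^+ 2 + x 0 1 ^+ 2.

Definition distance_set (K : finFieldType) (E F : {set 'rV[K]_2}) : {set K} :=
  [set norm2 (x - y) | x in E, y in F].

(* Main.v *)
Require Import Defs.
From mathcomp Require Import all_boot all_order all_algebra.
From mathcomp Require Import fingroup cyclic algC finfield classfun character.
From mathcomp Require Import ring lra.
From mathcomp Require Import reals exp.

Set Implicit Arguments.
Unset Strict Implicit.
Unset Printing Implicit Defensive.

Import Order.TTheory GRing.Theory Num.Theory.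

Local Open Scope ring_scope.

(** Write q for the cardinality of K, M for |E||F| and nu t for the number of pairs
    (x, y) in E * F with norm2 (x - y) = t. By Cauchy-Schwarz a bound of the form
    sum_(t <> 0) nu t ^ 2 <= C M ^ 2 / q forces at least a constant multiple of q
    nonzero distances, once it is known that nu 0 is at most M / 2. The value t = 0
    is set apart because the circle of radius 0 can contain isotropic lines; since
    any circle has at most 2q points, nu 0 ^ 2 <= 4 q ^ 2 M, which is harmless when
    M is much larger than q ^ 2.

    The second moment is controlled by Fourier analysis over a nontrivial additive
    character chi of K. Expanding the condition norm2 (x - y) = t in characters and
    completing the square turns nu t into a transform of
      H r = sum_(norm2 m = r) hat E m * conj (hat F m),
    because the Fourier transform of x |-> chi (s * norm2 x) is, up to the constant
    [gauss 1] of modulus q, the function m |-> chi (- norm2 m / (4 s)). It matters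
    that this constant is the same for all s <> 0 ([gauss_const]): then H 0, the only
    term that isotropic frequencies can make large, contributes to nu t the same
    amount for all t <> 0. The remaining frequencies contribute, by Parseval,
    at most sum_(r <> 0) |H r| ^ 2 up to powers of q ([sum_norm_remainder]).

    Finally |H r| ^ 2 is at most the product of the energies of hat E and hat F on the
    circle of radius r, and the restriction estimate for circles
    ([circle_restriction]) bounds such an energy, for r <> 0, by a multiple of
    q |E| ^ (3/2). It is dual to an L4 extension estimate ([circle_extension_L4]),
    which rests on the fact that a nonzero vector is a sum of two points of a circle in
    at most one way up to order ([circle_sum_unique]). Together with Plancherel this
    gives q ^ 2 sum_(t <> 0) nu t ^ 2 <= 3 q M ^ 2 + 3 q ^ 3 M + O(q ^ 3 M ^ (5/4))
    ([distance_count_moment]), and the last term is O(q M ^ 2) exactly when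
    M is at least a multiple of q ^ (8/3). *)

(** * Inequalities for finite sums *)

Lemma CauchySchwarz_norm (C : numDomainType) (I : finType) (P : pred I)
    (a b : I -> C) :
  `|\sum_(i | P i) a i * b i| ^+ 2 <=
    (\sum_(i | P i) `|a i| ^+ 2) * (\sum_(i | P i) `|b i| ^+ 2).
Proof.
set x := fun i => `|a i|; set y := fun i => `|b i|.
have xyge0 : 0 <= \sum_(i | P i) x i * y i.
  by apply: sumr_ge0 => i _; rewrite mulr_ge0 ?normr_ge0.
have le1 : `|\sum_(i | P i) a i * b i| <= \sum_(i | P i) x i * y i.
  by apply: le_trans (ler_norm_sum _ _ _) _; apply: ler_sum => i _; rewrite normrM.
apply: (@le_trans _ _ ((\sum_(i | P i) x i * y i) ^+ 2)).
  by rewrite lerXn2r // ?nnegrE ?normr_ge0.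
(* Lagrange's identity: twice the defect is a double sum of squares. *)
rewrite -subr_ge0 -(pmulr_rge0 _ (ltr0n C 2)).
suff -> : 2 * ((\sum_(i | P i) `|a i| ^+ 2) * (\sum_(i | P i) `|b i| ^+ 2) -
                (\sum_(i | P i) x i * y i) ^+ 2) =
    \sum_(i | P i) \sum_(j | P j) (x i * y j - x j * y i) ^+ 2.
  apply: sumr_ge0 => i _; apply: sumr_ge0 => j _.
  by rewrite -realEsqr rpredB // rpredM // normr_real.
have -> : \sum_(i | P i) \sum_(j | P j) (x i * y j - x j * y i) ^+ 2 =
    \sum_(i | P i) \sum_(j | P j) (x i ^+ 2 * y j ^+ 2) +
    \sum_(i | P i) \sum_(j | P j) (x j ^+ 2 * y i ^+ 2) -
    2 * \sum_(i | P i) \sum_(j | P j) (x i * y i) * (x j * y j).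
  rewrite mulr_sumr -big_split -sumrB /=; apply: eq_bigr => i _.
  rewrite mulr_sumr -big_split -sumrB /=; apply: eq_bigr => j _; ring.
rewrite [X in _ + X - _]exchange_big /= -!big_distrlr /=; ring.
Qed.

Lemma norm_sum_sqr_le (C : numDomainType) (I : finType) (A : {pred I})
    (a : I -> C) :
  `|\sum_(i in A) a i| ^+ 2 <= #|A|%:R * \sum_(i in A) `|a i| ^+ 2.
Proof.
have := CauchySchwarz_norm (mem A) (fun=> 1) a.
rewrite (eq_bigr a) => [|i _]; last by rewrite mul1r.
by under [X in _ <= X * _]eq_bigr => i _ do rewrite normr1 expr1n; rewrite sumr_const.
Qed.

Lemma norm_add3_sqr_le (C : numDomainType) (a b c : C) :
  `|a + b + c| ^+ 2 <= 3 * (`|a| ^+ 2 + `|b| ^+ 2 + `|c| ^+ 2).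
Proof.
apply: le_trans (_ : (`|a| + `|b| + `|c|) ^+ 2 <= _).
  rewrite lerXn2r ?nnegrE ?addr_ge0 //.
  by apply: le_trans (ler_normD _ _) _; rewrite lerD2r ler_normD.
rewrite -subr_ge0; set x := `|a|; set y := `|b|; set z := `|c|.
have -> : 3 * (x ^+ 2 + y ^+ 2 + z ^+ 2) - (x + y + z) ^+ 2 =
          (x - y) ^+ 2 + (y - z) ^+ 2 + (z - x) ^+ 2 by ring.
by rewrite !addr_ge0 // -realEsqr rpredB // normr_real.
Qed.

(** Only the orthogonality of the rows of [k] enters, so the same identity serves for
    characters of the line and of the plane. *)
Lemma Parseval (C : numClosedFieldType) (I J : finType) (k : I -> J -> C)
    (N : C) (a : I -> C) :
  (forall i i', \sum_j k i j * (k i' j)^* = N *+ (i == i')) ->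
  \sum_j `|\sum_i a i * k i j| ^+ 2 = N * \sum_i `|a i| ^+ 2.
Proof.
move=> orth.
under eq_bigr => j _ do rewrite normCK rmorph_sum big_distrlr /=.
rewrite exchange_big mulr_sumr /=; apply: eq_bigr => i _.
rewrite exchange_big /= (bigD1 i) //= [X in _ + X]big1 ?addr0 => [|i' ne].
  rewrite normCK.
  under eq_bigr => j _ do rewrite rmorphM /= mulrACA.
  by rewrite -mulr_sumr orth eqxx mulr1n mulrC.
under eq_bigr => j _ do rewrite rmorphM /= mulrACA.
by rewrite -mulr_sumr orth eq_sym (negPf ne) mulr0n mulr0.
Qed.

(** * Additive characters *)

Lemma sum_nontrivial_character (C : numClosedFieldType) (G : finZmodType)
    (psi : G -> C) (z : G) :
  {morph psi : x y / x + y >-> x * y} -> psi z != 1 -> \sum_x psi x = 0.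
Proof.
move=> psiD psiz.
have: \sum_x psi x = psi z * \sum_x psi x.
  rewrite {1}(reindex_inj (addrI z)) mulr_sumr.
  by apply: eq_bigr => x _; rewrite psiD.
move/eqP; rewrite -subr_eq0 -{1}[\sum_x _]mul1r -mulrBl mulf_eq0 subr_eq0 eq_sym.
by rewrite (negPf psiz) => /eqP.
Qed.

(** The additive group of K is abelian of order > 1, so it has as many irreducible
    characters as elements, all of them linear, and one of them is not principal. *)
Lemma exists_additive_character (K : finFieldType) :
  exists chi : K -> algC, [/\ {morph chi : x y / x + y >-> x * y},
    (forall x, `|chi x| = 1) & exists z, chi z != 1].
Proof.
have abK : abelian [set: K]%G by apply: FinRing.zmod_abelian.
have [i ni] : exists i : Iirr [set: K]%G, i != 0.
  have : (1 < #|Iirr [set: K]%G|)%N by rewrite card_Iirr_abelian // cardsT finNzRing_gt1.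
  by rewrite (cardD1 0) inE add1n ltnS => /card_gt0P [i]; rewrite inE => /andP[]; exists i.
have lin : 'chi_i \is a linear_char by apply/char_abelianP.
exists 'chi_i; split => [x y|x|].
- by have := lin_charM lin (in_setT x) (in_setT y); rewrite FinRing.zmodMgE.
- by rewrite (normC_lin_char lin) ?inE.
apply/existsP; apply: contraR ni => /existsPn h.
rewrite -irr_eq1; apply/eqP/cfunP => x.
by rewrite cfun1E inE; apply/eqP; have := h x; rewrite negbK.
Qed.

(** If 2 vanished, 1 would have order 2 in the additive group of K. *)
Lemma natr2_neq0 (K : finFieldType) : odd #|K| -> 2 != 0 :> K.
Proof.
move=> oddK; apply/negP => /eqP two0; move: oddK.
have : (#[1%R : K]%g %| #|[set: K]|)%N.
  by apply: (@order_dvdG _ [set: K]%G); rewrite inE.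
rewrite cardsT; have -> : #[1%R : K]%g = 2%N.
  apply: (@nt_prime_order K) => //; last by rewrite FinRing.zmod1gE oner_eq0.
by move=> /dvdnP [k ->]; rewrite muln2 odd_double.
Qed.

(** * The quadratic plane *)

Section Plane.

Variable K : finFieldType.
Implicit Types (x y z m v : 'rV[K]_2) (r s t u : K).

Definition dot x y : K := x 0 0 * y 0 0 + x 0 1 * y 0 1.

Lemma rV2P x y : x 0 0 = y 0 0 -> x 0 1 = y 0 1 -> x = y.
Proof.
move=> e0 e1; apply/rowP => -[[|[|//]] h].
  by have -> : Ordinal h = 0 by apply: val_inj.
by have -> : Ordinal h = 1 by apply: val_inj.
Qed.

Lemma dotDl x y z : dot (x + y) z = dot x z + dot y z.
Proof. by rewrite /dot !mxE; ring. Qed.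

Lemma dotDr x y z : dot x (y + z) = dot x y + dot x z.
Proof. by rewrite /dot !mxE; ring. Qed.

Lemma dotBl x y z : dot (x - y) z = dot x z - dot y z.
Proof. by rewrite /dot !mxE; ring. Qed.

Lemma dotC x y : dot x y = dot y x.
Proof. by rewrite /dot; ring. Qed.

Lemma dotZr t x y : dot x (t *: y) = t * dot x y.
Proof. by rewrite /dot !mxE; ring. Qed.

Lemma norm2D x y : norm2 (x + y) = norm2 x + 2 * dot x y + norm2 y.
Proof. by rewrite /norm2 /dot !mxE; ring. Qed.

Lemma dot_nondegenerate m : m != 0 -> forall t, exists z, dot z m = t.
Proof.
move=> m0 t; pose e (a b : K) : 'rV[K]_2 := \row_j (if j == 0 then a else b).
have [e0 | n0] := eqVneq (m 0 0) 0; last first.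
  by exists (e (t / m 0 0) 0); rewrite /dot !mxE /= mul0r addr0 divfK.
have n1 : m 0 1 != 0.
  by apply: contra_neq m0 => e1; apply: rV2P; rewrite mxE.
by exists (e 0 (t / m 0 1)); rewrite /dot !mxE /= mul0r add0r divfK.
Qed.

Lemma card_plane : #|{: 'rV[K]_2}| = (#|K| ^ 2)%N.
Proof. by rewrite card_mx mul1n. Qed.

(** Two points of a circle with prescribed sum [v] are determined up to swapping
    them: if [m] and [m'] are both solutions then [m' - m] and [m' - (v - m)] are
    orthogonal to [v] and to each other. The orthogonal of [v] is a line, so one of
    the two vanishes unless that line is isotropic, and then it contains the circle
    point [m], which would have norm zero. *)
Lemma circle_sum_unique (r : K) v m m' : 2 != 0 :> K -> r != 0 -> v != 0 ->
  norm2 m = r -> norm2 (v - m) = r -> norm2 m' = r -> norm2 (v - m') = r ->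
  m' = m \/ m' = v - m.
Proof.
rewrite /norm2 !mxE => two0 r0 v0.
have : (v 0 0 != 0) || (v 0 1 != 0).
  apply: contraR v0; rewrite negb_or !negbK => /andP [/eqP e0 /eqP e1].
  by apply/eqP/rV2P; rewrite mxE.
suff aux (a b c d e f : K) : (a != 0) || (b != 0) ->
    c ^+ 2 + d ^+ 2 = r -> (a - c) ^+ 2 + (b - d) ^+ 2 = r ->
    e ^+ 2 + f ^+ 2 = r -> (a - e) ^+ 2 + (b - f) ^+ 2 = r ->
    (e = c /\ f = d) \/ (e = a - c /\ f = b - d).
  move=> ab h1 h2 h3 h4; case: (aux _ _ _ _ _ _ ab h1 h2 h3 h4) => -[e1 e2].
    by left; apply: rV2P.
  by right; apply: rV2P; rewrite !mxE.
move=> ab h1 h2 h3 h4.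
pose p := e - c; pose q := f - d; pose p' := e - (a - c); pose q' := f - (b - d).
have o1 : p * a + q * b = 0.
  apply: (mulfI two0); rewrite mulr0 /p /q.
  transitivity (((e ^+ 2 + f ^+ 2) - ((a - e) ^+ 2 + (b - f) ^+ 2)) -
                ((c ^+ 2 + d ^+ 2) - ((a - c) ^+ 2 + (b - d) ^+ 2))); first by ring.
  by rewrite h1 h2 h3 h4 !subrr.
have o2 : p' * a + q' * b = 0.
  apply: (mulfI two0); rewrite mulr0 /p' /q'.
  transitivity (((e ^+ 2 + f ^+ 2) - ((a - e) ^+ 2 + (b - f) ^+ 2)) +
                ((c ^+ 2 + d ^+ 2) - ((a - c) ^+ 2 + (b - d) ^+ 2))); first by ring.
  by rewrite h1 h2 h3 h4 !subrr addr0.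
have o3 : p * p' + q * q' = 0.
  transitivity ((e ^+ 2 + f ^+ 2) - (c ^+ 2 + d ^+ 2) - (p * a + q * b)).
    by rewrite /p /q /p' /q'; ring.
  by rewrite o1 h1 h3 subrr subr0.
have o4 : (a ^+ 2 + b ^+ 2) = 2 * (c * a + d * b).
  transitivity (2 * (c * a + d * b) - ((c ^+ 2 + d ^+ 2) - ((a - c) ^+ 2 + (b - d) ^+ 2))).
    by ring.
  by rewrite h1 h2 subrr subr0.
have nz : a ^+ 2 + b ^+ 2 != 0.
  apply/eqP => ab0; move/negP: r0; apply; apply/eqP.
  have cd0 : c * a + d * b = 0 by apply: (mulfI two0); rewrite mulr0 -o4.
  case/orP: ab => n0; apply: (mulIf n0); apply: (mulIf n0); rewrite !mul0r -h1.
    have -> : (c ^+ 2 + d ^+ 2) * a * a = (c*a+d*b)*(c*a-d*b) + d^+2*(a^+2+b^+2) by ring.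
    by rewrite cd0 ab0 mul0r mulr0 addr0.
  have -> : (c ^+ 2 + d ^+ 2) * b * b = (c*a+d*b)*(d*b-c*a) + c^+2*(a^+2+b^+2) by ring.
  by rewrite cd0 ab0 mul0r mulr0 addr0.
have collinear (y z : K) : y * a + z * b = 0 -> z * a - y * b = 0 -> y = 0 /\ z = 0.
  move=> yz0 l0; split; apply: (mulIf nz); rewrite mul0r.
    have -> : y * (a ^+ 2 + b ^+ 2) = (y * a + z * b) * a - (z * a - y * b) * b by ring.
    by rewrite yz0 l0 !mul0r subr0.
  have -> : z * (a ^+ 2 + b ^+ 2) = (y * a + z * b) * b + (z * a - y * b) * a by ring.
  by rewrite yz0 l0 !mul0r addr0.
have /eqP : (q * a - p * b) * (q' * a - p' * b) = 0.
  transitivity ((p * p' + q * q') * (a ^+ 2 + b ^+ 2) -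
                (p * a + q * b) * (p' * a + q' * b)); first by ring.
  by rewrite o1 o3 !mul0r subr0.
rewrite mulf_eq0 => /orP [] /eqP l0; [left | right].
  by have [/subr0_eq -> /subr0_eq ->] := collinear _ _ o1 l0.
by have [/subr0_eq -> /subr0_eq ->] := collinear _ _ o2 l0.
Qed.

End Plane.

(** * Fourier analysis on the plane *)

Section Fourier.

Variables (C : numClosedFieldType) (K : finFieldType) (chi : K -> C).
Hypothesis two0 : 2 != 0 :> K.
Hypothesis chiD : {morph chi : x y / x + y >-> x * y}.
Hypothesis norm_chi : forall x, `|chi x| = 1.
Hypothesis chi_nontrivial : exists z, chi z != 1.

Implicit Types (x y z m v : 'rV[K]_2) (r s t u : K) (E F : {set 'rV[K]_2}).

Local Notation q := (#|K|%:R : C).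

Lemma q_gt0 : 0 < q.
Proof. by rewrite ltr0n; apply/card_gt0P; exists 0. Qed.

Lemma chi0 : chi 0 = 1.
Proof.
have n0 : chi 0 != 0 by rewrite -normr_gt0 norm_chi.
by apply: (mulfI n0); rewrite -chiD addr0 mulr1.
Qed.

Lemma chiN t : chi (- t) = (chi t)^*.
Proof.
have n0 : chi t != 0 by rewrite -normr_gt0 norm_chi.
by apply: (mulfI n0); rewrite -normCK norm_chi expr1n -chiD subrr chi0.
Qed.

Lemma chi_conjM s t : chi s * (chi t)^* = chi (s - t).
Proof. by rewrite chiD chiN. Qed.

Lemma sum_chi_line s : \sum_t chi (s * t) = q *+ (s == 0).
Proof.
have [->|n0] := eqVneq.
  by under eq_bigr do rewrite mul0r chi0; rewrite sumr_const.
have [z nz] := chi_nontrivial.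
apply: (@sum_nontrivial_character _ K _ (z / s)) => [x y|]; first by rewrite mulrDr chiD.
by rewrite mulrC divfK.
Qed.

Lemma sum_chi_plane m : \sum_x chi (dot x m) = q ^+ 2 *+ (m == 0).
Proof.
have [->|n0] := eqVneq.
  under eq_bigr do rewrite /dot !mxE !mulr0 addr0 chi0.
  by rewrite sumr_const card_plane natrX.
have [z nz] := chi_nontrivial.
have [w wz] := dot_nondegenerate n0 z.
apply: (@sum_nontrivial_character _ _ _ w) => [x y|]; first by rewrite dotDl chiD.
by rewrite wz.
Qed.

Lemma chi_orthogonal_line s s' :
  \sum_t chi (- (s * t)) * (chi (- (s' * t)))^* = q *+ (s == s').
Proof.
under eq_bigr do rewrite chi_conjM opprK addrC -mulrBl.
by rewrite sum_chi_line subr_eq0 eq_sym.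
Qed.

Lemma chi_orthogonal_plane x x' :
  \sum_m chi (dot x m) * (chi (dot x' m))^* = q ^+ 2 *+ (x == x').
Proof.
under eq_bigr do rewrite chi_conjM -dotBl dotC.
by rewrite sum_chi_plane subr_eq0.
Qed.

(** * Gauss sums and the size of circles *)

Definition gauss u := \sum_x chi (u * norm2 x).

(** The difference variable z = x - y linearises the double sum |gauss u| ^ 2:
    the sum over y is then a full character sum, which only z = 0 survives. *)
Lemma norm_gauss u : u != 0 -> `|gauss u| = q.
Proof.
move=> u0; apply/eqP; rewrite -(eqrXn2 (n := 2)) ?normr_ge0 ?ler0n //; apply/eqP.
rewrite normCK /gauss rmorph_sum big_distrlr exchange_big /=.
under eq_bigr => y _.
  rewrite (reindex_inj (addrI y)) /=.
  under eq_bigr => z _.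
    rewrite chi_conjM norm2D -mulrBr.
    have -> : u * (norm2 y + 2 * dot y z + norm2 z - norm2 y) =
              dot y ((2 * u) *: z) + u * norm2 z by rewrite dotZr; ring.
    rewrite chiD; over.
  over.
rewrite exchange_big /= (bigD1 0) //= [X in _ + X]big1 ?addr0 => [|z z0].
  rewrite -mulr_suml sum_chi_plane scaler0 eqxx mulr1n /norm2 !mxE.
  by rewrite expr0n addr0 mulr0 chi0 mulr1.
rewrite -mulr_suml sum_chi_plane scaler_eq0 mulf_eq0.
by rewrite (negPf two0) (negPf u0) (negPf z0) mul0r.
Qed.

Definition circle r : {set 'rV[K]_2} := [set x | norm2 x == r].

Lemma in_circle r x : (x \in circle r) = (norm2 x == r).
Proof. by rewrite inE. Qed.

(** In the character expansion of the number of points on a circle the trivial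
    frequency gives q ^ 2, and the q - 1 others are Gauss sums of modulus q. The
    error is strictly below the main term, so no circle is empty. *)
Lemma card_circle_near t : `|q * #|circle t|%:R - q ^+ 2| <= (q - 1) * q.
Proof.
have -> : q * #|circle t|%:R = \sum_u chi (- (u * t)) * gauss u.
  rewrite /gauss; under [RHS]eq_bigr => u _ do rewrite mulr_sumr.
  rewrite exchange_big /= -[#|circle t|]sum1_card natr_sum mulr_sumr big_mkcond /=.
  apply: eq_bigr => x _; rewrite in_circle mulr1.
  under eq_bigr => u _ do rewrite -chiD addrC -mulrBr mulrC.
  by rewrite sum_chi_line subr_eq0; case: eqP.
rewrite (bigD1 0) //= mul0r oppr0 chi0 mul1r.
have -> : gauss 0 = q ^+ 2.
  by rewrite /gauss; under eq_bigr do rewrite mul0r chi0; rewrite sumr_const card_plane natrX.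
rewrite addrC addrK; apply: le_trans (ler_norm_sum _ _ _) _.
rewrite (eq_bigr (fun=> q)) => [|u u0]; last by rewrite normrM norm_chi mul1r norm_gauss.
rewrite sumr_const -[X in X <= _]mulr_natl (_ : #|_| = #|K|.-1) ?predn_cardT //.
  by rewrite -subn1 natrB // ; apply/card_gt0P; exists 0.
by rewrite (cardC1 (0 : K)).
Qed.

Lemma circle_nonempty t : exists x, norm2 x = t.
Proof.
have [x|e] := pickP [pred x | norm2 x == t]; first by move/eqP; exists x.
have := card_circle_near t.
have -> : circle t = set0 by apply/setP => x; rewrite inE in_set0; exact: e.
rewrite cards0 mulr0 sub0r normrN normrX ger0_norm ?ler0n // expr2.
by rewrite ler_pM2r ?q_gt0 // -subr_ge0 addrAC subrr sub0r oppr_ge0 ler10.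
Qed.

Lemma card_circle_le t : (#|circle t| <= 2 * #|K|)%N.
Proof.
rewrite -(ler_nat C) -(ler_pM2l q_gt0) natrM.
have /real_ler_norm : q * #|circle t|%:R - q ^+ 2 \is Num.real.
  by rewrite rpredB // ?rpredX ?rpredM // realn.
move=> /le_trans /(_ (card_circle_near t)); rewrite lerBlDr => /le_trans -> //.
rewrite -subr_ge0; have -> : q * (2 * q) - ((q - 1) * q + q ^+ 2) = q by ring.
exact: ler0n.
Qed.

(** Every scalar is a norm, and multiplication by [a + ib] scales norms by
    [a ^+ 2 + b ^+ 2], so all nontrivial dilates of the quadratic Gauss sum agree. *)
Lemma gauss_const u : u != 0 -> gauss u = gauss 1.
Proof.
move=> u0; have [w wu] := circle_nonempty u.
pose f x : 'rV[K]_2 :=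
  \row_j (if j == 0 then w 0 0 * x 0 0 - w 0 1 * x 0 1
          else w 0 1 * x 0 0 + w 0 0 * x 0 1).
have norm_f x : norm2 (f x) = u * norm2 x.
  by rewrite -wu /norm2 !mxE /=; ring.
have f_inj : injective f.
  move=> x y fxy; have e0 : f x 0 0 = f y 0 0 by rewrite fxy.
  have e1 : f x 0 1 = f y 0 1 by rewrite fxy.
  move: e0 e1; rewrite !mxE /= => e0 e1.
  apply: rV2P; apply: (mulfI u0); rewrite -wu /norm2.
    transitivity (w 0 0 * (w 0 0 * x 0 0 - w 0 1 * x 0 1) +
                  w 0 1 * (w 0 1 * x 0 0 + w 0 0 * x 0 1)); first by ring.
    by rewrite e0 e1; ring.
  transitivity (w 0 0 * (w 0 1 * x 0 0 + w 0 0 * x 0 1) -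
                w 0 1 * (w 0 0 * x 0 0 - w 0 1 * x 0 1)); first by ring.
  by rewrite e0 e1; ring.
rewrite /gauss [RHS](reindex_inj f_inj).
by apply: eq_bigr => x _; rewrite norm_f mul1r.
Qed.


(** * Restriction to circles *)

Definition hat E m := \sum_(x in E) chi (dot x m).

Lemma sum_norm_hat E : \sum_m `|hat E m| ^+ 2 = q ^+ 2 * #|E|%:R.
Proof.
have -> : #|E|%:R = \sum_x `|(x \in E)%:R : C| ^+ 2.
  rewrite -sum1_card natr_sum big_mkcond /=; apply: eq_bigr => x _.
  by case: (x \in E); rewrite ?normr1 ?normr0 ?expr1n ?expr0n.
rewrite -(Parseval _ chi_orthogonal_plane); apply: eq_bigr => m _.
congr (`|_| ^+ 2); rewrite /hat big_mkcond; apply: eq_bigr => x _.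
by case: (x \in E); rewrite ?mul1r ?mul0r.
Qed.

(** The square of the extension of [a] is the extension of the self-convolution of
    [a], so by Parseval the fourth moment counts additive quadruples of circle points.
    At v <> 0 the convolution has at most two terms; at v = 0 it may have as many
    terms as the circle has points, but a single v can be treated by Cauchy-Schwarz. *)
Lemma circle_extension_L4 r (a : 'rV[K]_2 -> C) : r != 0 ->
  (forall m, norm2 m != r -> a m = 0) ->
  \sum_x `|\sum_m a m * chi (dot x m)| ^+ 4 <=
    3 * q ^+ 2 * (\sum_m `|a m| ^+ 2) ^+ 2.
Proof.
move=> r0 supp; set S := \sum_m `|a m| ^+ 2.
pose conv v := \sum_m a m * a (v - m).
have sqE x : (\sum_m a m * chi (dot x m)) ^+ 2 = \sum_v conv v * chi (dot x v).
  rewrite expr2 big_distrlr /=.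
  under eq_bigr => m _ do rewrite (reindex_inj (addIr (- m))) /=.
  rewrite exchange_big; apply: eq_bigr => v _; rewrite mulr_suml.
  by apply: eq_bigr => m _; rewrite mulrACA -chiD -dotDr [m + _]addrC subrK.
have -> : \sum_x `|\sum_m a m * chi (dot x m)| ^+ 4 = q ^+ 2 * \sum_v `|conv v| ^+ 2.
  rewrite -(Parseval _ chi_orthogonal_plane); apply: eq_bigr => x _.
  rewrite (exprM _ 2 2) -normrX sqE; congr (`|_| ^+ 2).
  by apply: eq_bigr => v _; rewrite dotC.
rewrite (_ : 3 * q ^+ 2 * S ^+ 2 = q ^+ 2 * (3 * S ^+ 2)); last by ring.
rewrite ler_pM2l ?exprn_gt0 ?q_gt0 //.
have conv0 : `|conv 0| ^+ 2 <= S ^+ 2.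
  apply: le_trans (CauchySchwarz_norm _ _ _) _.
  rewrite expr2 [X in _ * X](reindex_inj oppr_inj) /=.
  by under [X in _ * X <= _]eq_bigr do rewrite sub0r opprK.
have convN v : v != 0 -> `|conv v| ^+ 2 <= 2 * \sum_m `|a m| ^+ 2 * `|a (v - m)| ^+ 2.
  move=> v0; pose A := [set m | (norm2 m == r) && (norm2 (v - m) == r)].
  have offA m : m \notin A -> a m * a (v - m) = 0.
    by rewrite inE negb_and => /orP [] /supp ->; rewrite ?mul0r ?mulr0.
  have -> : conv v = \sum_(m in A) a m * a (v - m).
    rewrite /conv (bigID (mem A)) /= [X in _ + X]big1 ?addr0 // => m; exact: offA.
  have cardA : (#|A| <= 2)%N.
    have [-> | [m0]] := set_0Vmem A; first by rewrite cards0.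
    rewrite inE => /andP [/eqP h1 /eqP h2].
    apply: (@leq_trans #|[set m0; v - m0]|); last by rewrite cards2; case: eqP.
    apply/subset_leq_card/subsetP => m; rewrite !inE => /andP [/eqP h3 /eqP h4].
    by have [->|->] := circle_sum_unique two0 r0 v0 h1 h2 h3 h4; rewrite eqxx ?orbT.
  apply: le_trans (norm_sum_sqr_le _ _) _.
  apply: ler_pM; rewrite ?ler0n ?ler_nat //.
    by apply: sumr_ge0 => m _; rewrite exprn_ge0.
  rewrite [X in _ <= X](bigID (mem A)) /=.
  under eq_bigr do rewrite normrM exprMn.
  by rewrite lerDl sumr_ge0 // => m _; rewrite mulr_ge0 ?exprn_ge0.
have S2 : \sum_v \sum_m `|a m| ^+ 2 * `|a (v - m)| ^+ 2 = S ^+ 2.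
  rewrite exchange_big expr2 mulr_suml; apply: eq_bigr => m _.
  by rewrite -mulr_sumr [S in RHS](reindex_inj (addIr (- m))).
have -> : 3 * S ^+ 2 = S ^+ 2 + 2 * S ^+ 2 by ring.
rewrite (bigD1 0) //=; apply: lerD => //.
rewrite -S2 mulr_sumr [X in _ <= X](bigD1 0) //=.
apply: le_trans (_ : \sum_(i | i != 0) 2 * \sum_m `|a m| ^+ 2 * `|a (i - m)| ^+ 2 <= _).
  by apply: ler_sum => v; exact: convN.
by rewrite lerDr mulr_ge0 ?ler0n ?sumr_ge0 // => m _; rewrite mulr_ge0 ?exprn_ge0.
Qed.

Definition circle_energy E r := \sum_(m | norm2 m == r) `|hat E m| ^+ 2.

Lemma circle_energy_ge0 E r : 0 <= circle_energy E r.
Proof. by apply: sumr_ge0 => m _; rewrite exprn_ge0. Qed.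

(** Duality: the energy S is the sum over E of the extension of conj (hat E)
    restricted to the circle. Hoelder's inequality, as two applications of
    Cauchy-Schwarz, bounds S ^ 4 by |E| ^ 3 times the fourth moment of that extension,
    which is at most 3 q ^ 2 S ^ 2. *)
Lemma circle_restriction E r : r != 0 ->
  circle_energy E r ^+ 2 <= 3 * q ^+ 2 * #|E|%:R ^+ 3.
Proof.
move=> r0; set S := circle_energy E r.
have S0 : 0 <= S := circle_energy_ge0 E r.
pose a m := if norm2 m == r then (hat E m)^* else 0.
pose ext x := \sum_m a m * chi (dot x m).
have Sa : \sum_m `|a m| ^+ 2 = S.
  rewrite /S /circle_energy [RHS]big_mkcond; apply: eq_bigr => m _.
  by rewrite /a; case: ifP => _; rewrite ?norm_conjC // normr0 expr0n.
have Sext : \sum_(x in E) ext x = S.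
  rewrite exchange_big /S /circle_energy [RHS]big_mkcond; apply: eq_bigr => m _.
  rewrite -mulr_sumr -/(hat E m) /a; case: ifP => _; last by rewrite mul0r.
  by rewrite normCK mulrC.
have L4 : \sum_x `|ext x| ^+ 4 <= 3 * q ^+ 2 * S ^+ 2.
  rewrite -Sa; apply: circle_extension_L4 r0 _ => m.
  by rewrite /a => /negPf ->.
have L2 : S ^+ 2 <= #|E|%:R * \sum_(x in E) `|ext x| ^+ 2.
  by have := norm_sum_sqr_le (mem E) ext; rewrite Sext ger0_norm.
have L24 : (\sum_(x in E) `|ext x| ^+ 2) ^+ 2 <= #|E|%:R * (3 * q ^+ 2 * S ^+ 2).
  have := norm_sum_sqr_le (mem E) (fun x => `|ext x| ^+ 2).
  rewrite ger0_norm => [/le_trans -> //|]; last by apply: sumr_ge0 => x _; rewrite exprn_ge0.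
  rewrite ler_wpM2l ?ler0n //; apply: le_trans L4.
  rewrite [X in _ <= X](bigID (mem E)) /=.
  under eq_bigr do rewrite ger0_norm ?exprn_ge0 // -exprM.
  by rewrite lerDl sumr_ge0 // => x _; rewrite exprn_ge0.
have [->|Sn0] := eqVneq S 0.
  by rewrite expr0n !mulr_ge0 ?exprn_ge0 ?ler0n.
have S2 : 0 < S ^+ 2 by rewrite exprn_gt0 // lt_def Sn0.
rewrite -(ler_pM2r S2).
have : (S ^+ 2) ^+ 2 <= (#|E|%:R * \sum_(x in E) `|ext x| ^+ 2) ^+ 2.
  rewrite lerXn2r // nnegrE ?exprn_ge0 // mulr_ge0 ?ler0n // sumr_ge0 // => x _.
  by rewrite exprn_ge0.
rewrite -[S ^+ 2 * S ^+ 2]expr2 => /le_trans -> //; rewrite exprMn.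
apply: le_trans (ler_wpM2l _ L24) _; first by rewrite exprn_ge0 ?ler0n.
by rewrite le_eqVlt; apply/orP; left; apply/eqP; ring.
Qed.

(** * The distance counting function *)

Definition distance_count E F t : nat :=
  #|[set p in setX E F | norm2 (p.1 - p.2) == t]|.

Section DistanceCounts.

Variables E F : {set 'rV[K]_2}.

Local Notation nu := (distance_count E F).
Local Notation M := ((#|E| * #|F|)%:R : C).

Definition distance_sum s := \sum_(x in E) \sum_(y in F) chi (s * norm2 (x - y)).

Lemma distance_count_Fourier t :
  q * (nu t)%:R = \sum_s chi (- (s * t)) * distance_sum s.
Proof.
have -> : (nu t)%:R = \sum_(x in E) \sum_(y in F) ((norm2 (x - y) == t)%:R : C).
  rewrite pair_big /= /distance_count -sum1_card natr_sum big_mkcond [RHS]big_mkcond /=.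
  apply: eq_bigr => -[x y] _; rewrite !inE /=.
  by case: (x \in E); case: (y \in F); case: (_ == _).
rewrite /distance_sum; under [RHS]eq_bigr => s _ do rewrite mulr_sumr.
rewrite [RHS]exchange_big mulr_sumr /=; apply: eq_bigr => x _.
under [RHS]eq_bigr => s _ do rewrite mulr_sumr.
rewrite [RHS]exchange_big mulr_sumr /=; apply: eq_bigr => y _.
under [RHS]eq_bigr => s _ do rewrite -chiD addrC -mulrBr mulrC.
by rewrite sum_chi_line subr_eq0; case: (_ == _); rewrite ?mulr1 ?mulr0.
Qed.

(** Completing the square in norm2 m / (4 s), with the substitution
    m |-> m + 2 s z, shows that m |-> chi (- norm2 m / (4 s)) has Fourier transform
    gauss 1 * chi (s * norm2 z). *)
Lemma distance_sum_dual s : s != 0 ->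
  gauss 1 * distance_sum s =
  \sum_m chi (- (norm2 m * (4 * s)^-1)) * (hat E m * (hat F m)^*).
Proof.
move=> s0; have four0 : 4 != 0 :> K.
  by rewrite (natrM K 2 2) mulf_neq0.
set u := (4 * s)^-1.
have u0 : - u != 0 by rewrite oppr_eq0 invr_eq0 mulf_neq0.
have us : u * (4 * s) = 1 by rewrite mulVf ?mulf_neq0.
have kernel z : \sum_m chi (- (norm2 m * u)) * chi (dot z m) = gauss 1 * chi (s * norm2 z).
  rewrite (reindex_inj (addIr ((2 * s) *: z))) /= -(gauss_const u0) mulr_suml.
  apply: eq_bigr => m _; rewrite -!chiD; congr chi.
  rewrite norm2D dotDr !dotZr (dotC z m).
  have -> : dot z z = norm2 z by rewrite /dot /norm2; ring.
  have -> : norm2 ((2 * s) *: z) = 4 * s ^+ 2 * norm2 z by rewrite /norm2 !mxE; ring.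
  transitivity (- u * norm2 m + dot m z * (1 - u * (4 * s)) +
                s * norm2 z * (2 - u * (4 * s))); first by ring.
  by rewrite us; ring.
under [RHS]eq_bigr => m _.
  rewrite /hat rmorph_sum big_distrlr mulr_sumr /=.
  under eq_bigr => x _ do rewrite mulr_sumr.
  over.
rewrite [RHS]exchange_big mulr_sumr /=; apply: eq_bigr => x _.
rewrite [RHS]exchange_big mulr_sumr /=; apply: eq_bigr => y _.
by rewrite -kernel; apply: eq_bigr => m _; rewrite chi_conjM -dotBl.
Qed.

Definition cross_energy r := \sum_(m | norm2 m == r) hat E m * (hat F m)^*.

(** The frequency r = 0 is removed here; it appears separately in
    [distance_count_decomposition]. *)
Definition cross_transform u :=
  \sum_r (if r == 0 then 0 else cross_energy r) * chi (- (r * u)).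

Definition remainder t :=
  \sum_s (if s == 0 then 0 else cross_transform (4 * s)^-1) * chi (- (s * t)).

(** The frequency s = 0 yields the expected count M. For s <> 0 the isotropic part
    [cross_energy 0] does not depend on s, and the nontrivial values of a character
    at t <> 0 sum to -1. *)
Lemma distance_count_decomposition t : t != 0 ->
  gauss 1 * (q * (nu t)%:R) = gauss 1 * M - cross_energy 0 + remainder t.
Proof.
move=> t0; rewrite distance_count_Fourier (bigD1 0) //= mulrDr -addrA; congr (_ + _).
  rewrite mul0r oppr0 chi0 mul1r; congr (_ * _).
  rewrite /distance_sum natrM.
  under eq_bigr => x _ do under eq_bigr => y _ do rewrite mul0r chi0.
  by under eq_bigr => x _ do rewrite sumr_const; rewrite sumr_const -[LHS]mulr_natl.
rewrite /remainder [X in _ = _ + X](bigD1 0) //= eqxx mul0r add0r.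
have -> : - cross_energy 0 = \sum_(s | s != 0) cross_energy 0 * chi (- (s * t)).
  rewrite -mulr_sumr; suff -> : \sum_(s | s != 0) chi (- (s * t)) = -1 by rewrite mulrN1.
  apply/eqP; rewrite eq_sym -subr_eq0 -opprD oppr_eq0; apply/eqP.
  transitivity (\sum_s chi ((- t) * s)); last first.
    by rewrite sum_chi_line oppr_eq0 (negPf t0).
  rewrite [RHS](bigD1 0) //= mulr0 chi0; congr (_ + _).
  by apply: eq_bigr => s _; rewrite mulNr mulrC.
rewrite -big_split mulr_sumr /=; apply: eq_bigr => s s0.
rewrite mulrCA distance_sum_dual // (negPf s0) -mulrDl mulrC; congr (_ * _).
rewrite (partition_big (@norm2 K) predT) //= (bigD1 0) //=; congr (_ + _).
  by apply: eq_bigr => m /eqP ->; rewrite mul0r oppr0 chi0 mul1r.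
rewrite /cross_transform [RHS](bigD1 0) //= eqxx mul0r add0r.
apply: eq_bigr => r r0; rewrite (negPf r0) /cross_energy mulr_suml.
by apply: eq_bigr => m /eqP ->; rewrite mulrC.
Qed.

(** Parseval twice: in t, and then, as s |-> 1 / (4 s) is a permutation of K once
    0 is sent to 0, in the dual variable of [cross_transform]. *)
Lemma sum_norm_remainder :
  \sum_t `|remainder t| ^+ 2 <= q ^+ 2 * \sum_(r | r != 0) `|cross_energy r| ^+ 2.
Proof.
rewrite (Parseval _ chi_orthogonal_line) expr2 -mulrA ler_pM2l ?q_gt0 //.
have -> : q * \sum_(r | r != 0) `|cross_energy r| ^+ 2 = \sum_v `|cross_transform v| ^+ 2.
  rewrite (Parseval _ chi_orthogonal_line); congr (_ * _); rewrite big_mkcond.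
  by apply: eq_bigr => r _; case: eqP; rewrite ?normr0 ?expr0n.
have inj4 : injective (fun s : K => (4 * s)^-1).
  move=> s s' /invr_inj; apply: mulfI.
  by rewrite (natrM K 2 2) mulf_neq0.
rewrite [X in _ <= X](reindex_inj inj4) /=; apply: ler_sum => s _.
by case: eqP => _; rewrite // normr0 expr0n exprn_ge0.
Qed.

Lemma norm_cross_energy r :
  `|cross_energy r| ^+ 2 <= circle_energy E r * circle_energy F r.
Proof.
apply: le_trans (CauchySchwarz_norm _ _ _) _.
by under [X in _ * X <= _]eq_bigr do rewrite norm_conjC.
Qed.

End DistanceCounts.

(** Fixing either endpoint confines the other to a circle, which has at most 2q
    points; the two resulting bounds are multiplied. *)
Lemma distance_count_sqr_le E F t :
  (distance_count E F t ^ 2 <= 4 * #|K| ^ 2 * (#|E| * #|F|))%N.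
Proof.
have leE : (distance_count E F t <= #|E| * (2 * #|K|))%N.
  apply: leq_trans (leq_mul (leqnn _) (card_circle_le t)); rewrite -cardsX.
  have inj : injective (fun p : 'rV[K]_2 * 'rV[K]_2 => (p.1, p.1 - p.2)).
    by move=> [x y] [x' y'] /= [-> /addrI /oppr_inj ->].
  rewrite /distance_count; set A := [set p in _ | _].
  rewrite -(card_imset A inj); apply: subset_leq_card.
  apply/subsetP => y /imsetP [p pEF ->]; move: pEF.
  by rewrite !inE /= => /andP [/andP [-> _]].
have leF : (distance_count E F t <= #|F| * (2 * #|K|))%N.
  apply: leq_trans (leq_mul (leqnn _) (card_circle_le t)); rewrite -cardsX.
  have inj : injective (fun p : 'rV[K]_2 * 'rV[K]_2 => (p.2, p.1 - p.2)).
    by move=> [x y] [x' y'] /= [-> /addIr ->].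
  rewrite /distance_count; set A := [set p in _ | _].
  rewrite -(card_imset A inj); apply: subset_leq_card.
  apply/subsetP => y /imsetP [p pEF ->]; move: pEF.
  by rewrite !inE /= => /andP [/andP [_ ->]].
rewrite expnS expn1; apply: leq_trans (leq_mul leE leF) _.
by rewrite leq_eqVlt; apply/orP; left; apply/eqP; ring.
Qed.

Lemma sum_circle_energy E : \sum_r circle_energy E r = q ^+ 2 * #|E|%:R.
Proof. by rewrite -sum_norm_hat [RHS](partition_big (@norm2 K) predT). Qed.

Lemma circle_energy_le E r : circle_energy E r <= q ^+ 2 * #|E|%:R.
Proof.
rewrite -sum_circle_energy (bigD1 r) //= lerDl.
by apply: sumr_ge0 => r' _; exact: circle_energy_ge0.
Qed.

(** One factor of each square is bounded by the restriction estimate, the other is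
    summed by Plancherel. *)
Lemma sum_circle_energy_sqr E :
  (\sum_(r | r != 0) circle_energy E r ^+ 2) ^+ 2 <= 3 * q ^+ 6 * #|E|%:R ^+ 5.
Proof.
set B := sqrtC (3 * q ^+ 2 * #|E|%:R ^+ 3).
have B2 : B ^+ 2 = 3 * q ^+ 2 * #|E|%:R ^+ 3 by rewrite sqrtCK.
have B0 : 0 <= B by rewrite sqrtC_ge0 !mulr_ge0 ?exprn_ge0 ?ler0n.
have leB r : r != 0 -> circle_energy E r <= B.
  move=> r0; rewrite -ler_sqr ?nnegrE ?circle_energy_ge0 // B2.
  exact: circle_restriction.
have T0 : 0 <= \sum_(r | r != 0) circle_energy E r ^+ 2.
  by apply: sumr_ge0 => r _; rewrite exprn_ge0 ?circle_energy_ge0.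
have le1 : \sum_(r | r != 0) circle_energy E r ^+ 2 <= B * (q ^+ 2 * #|E|%:R).
  rewrite -sum_circle_energy [X in B * X](bigD1 0) //= mulrDr.
  apply: le_trans (_ : \sum_(r | r != 0) B * circle_energy E r <= _).
    by apply: ler_sum => r r0; rewrite expr2 ler_wpM2r ?circle_energy_ge0 ?leB.
  by rewrite -mulr_sumr lerDr mulr_ge0 ?circle_energy_ge0.
apply: le_trans (_ : (B * (q ^+ 2 * #|E|%:R)) ^+ 2 <= _).
  by rewrite lerXn2r // nnegrE // !mulr_ge0 ?exprn_ge0 ?ler0n.
rewrite exprMn B2 le_eqVlt; apply/orP; left; apply/eqP; ring.
Qed.

(** The truncated difference is the part of the second moment beyond the main terms;
    its fourth power clears the exponent 5/4 of M, so that the bound is a statement on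
    natural numbers that can be transported to any ordered field. *)
Lemma distance_count_moment E F :
  ((#|K| ^ 2 * \sum_(t : K | t != 0%R) distance_count E F t ^ 2
    - (3 * #|K| * (#|E| * #|F|) ^ 2 + 3 * #|K| ^ 3 * (#|E| * #|F|))) ^ 4
   <= 729 * #|K| ^ 12 * (#|E| * #|F|) ^ 5)%N.
Proof.
set M := (#|E| * #|F|)%N; set X := (\sum_(t | _) _)%N.
(* The nonisotropic contribution; the restriction estimate enters through [Q4]. *)
pose Q := \sum_(r | r != 0) circle_energy E r * circle_energy F r.
have Q0 : 0 <= Q.
  by apply: sumr_ge0 => r _; rewrite mulr_ge0 ?circle_energy_ge0.
have MC : M%:R = #|E|%:R * #|F|%:R :> C by rewrite natrM.
have Q4 : Q ^+ 4 <= 9 * q ^+ 12 * M%:R ^+ 5.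
  have Q2 : Q ^+ 2 <= (\sum_(r | r != 0) circle_energy E r ^+ 2) *
                      (\sum_(r | r != 0) circle_energy F r ^+ 2).
    have := CauchySchwarz_norm (fun r => r != 0) (circle_energy E) (circle_energy F).
    rewrite -/Q ger0_norm // => /le_trans -> //.
    by under eq_bigr do rewrite ger0_norm ?circle_energy_ge0 //;
       under [X in _ * X <= _]eq_bigr do rewrite ger0_norm ?circle_energy_ge0 //.
  have T0 G : 0 <= \sum_(r | r != 0) circle_energy G r ^+ 2.
    by apply: sumr_ge0 => r _; rewrite exprn_ge0 ?circle_energy_ge0.
  rewrite (exprM _ 2 2).
  apply: le_trans (_ : ((\sum_(r | r != 0) circle_energy E r ^+ 2) *
                        (\sum_(r | r != 0) circle_energy F r ^+ 2)) ^+ 2 <= _).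
    by rewrite lerXn2r // nnegrE ?exprn_ge0 ?mulr_ge0.
  rewrite exprMn.
  apply: le_trans (ler_pM _ _ (sum_circle_energy_sqr E) (sum_circle_energy_sqr F)) _.
  - by rewrite exprn_ge0.
  - by rewrite exprn_ge0.
  by rewrite MC le_eqVlt; apply/orP; left; apply/eqP; ring.
have cross0 : `|cross_energy E F 0| ^+ 2 <= q ^+ 4 * M%:R.
  apply: le_trans (norm_cross_energy E F 0) _.
  apply: le_trans (ler_pM _ _ (circle_energy_le E 0) (circle_energy_le F 0)) _;
    rewrite ?circle_energy_ge0 //.
  by rewrite MC le_eqVlt; apply/orP; left; apply/eqP; ring.
have rem : \sum_t `|remainder E F t| ^+ 2 <= q ^+ 2 * Q.
  apply: le_trans (sum_norm_remainder E F) _.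
  rewrite ler_wpM2l ?exprn_ge0 ?ler0n //; apply: ler_sum => r _.
  exact: norm_cross_energy.
have term t : t != 0 -> q ^+ 4 * (distance_count E F t)%:R ^+ 2 <=
    3 * (q ^+ 2 * M%:R ^+ 2 + q ^+ 4 * M%:R + `|remainder E F t| ^+ 2).
  move=> t0.
  have -> : q ^+ 4 * (distance_count E F t)%:R ^+ 2 =
            `|gauss 1 * (q * (distance_count E F t)%:R)| ^+ 2.
    rewrite normrM norm_gauss ?oner_neq0 // ger0_norm ?mulr_ge0 ?ler0n //.
    by ring.
  rewrite distance_count_decomposition //.
  apply: le_trans (norm_add3_sqr_le _ _ _) _.
  rewrite ler_pM2l ?ltr0n // normrN normrM norm_gauss ?oner_neq0 //.
  by rewrite exprMn (ger0_norm (ler0n _ _)) !lerD.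
have total : q ^+ 2 * (q ^+ 2 * X%:R) <=
             q ^+ 2 * (3 * q * M%:R ^+ 2 + 3 * q ^+ 3 * M%:R + 3 * Q).
  rewrite mulrA -exprD natr_sum mulr_sumr.
  under eq_bigr => t _ do rewrite natrX.
  apply: le_trans (ler_sum _ term) _; rewrite -mulr_sumr.
  apply: le_trans (_ : 3 * (\sum_(t : K) (q ^+ 2 * M%:R ^+ 2 + q ^+ 4 * M%:R +
                                    `|remainder E F t| ^+ 2)) <= _).
    rewrite ler_pM2l ?ltr0n // [X in _ <= X](bigD1 0) //= lerDr.
    by rewrite !addr_ge0 ?mulr_ge0 ?exprn_ge0 ?ler0n.
  rewrite big_split sumr_const /= -[(_ + _) *+ #|_|]mulr_natl.
  apply: le_trans (_ : 3 * (q * (q ^+ 2 * M%:R ^+ 2 + q ^+ 4 * M%:R) + q ^+ 2 * Q) <= _).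
    by rewrite ler_pM2l ?ltr0n // lerD2l.
  by rewrite le_eqVlt; apply/orP; left; apply/eqP; ring.
move: total; rewrite ler_pM2l ?exprn_gt0 ?q_gt0 // => total.
set Y := (3 * #|K| * M ^ 2 + 3 * #|K| ^ 3 * M)%N.
have YC : Y%:R = 3 * q * M%:R ^+ 2 + 3 * q ^+ 3 * M%:R :> C.
  by rewrite /Y natrD !(natrX, natrM).
have [leXY|/ltnW leYX] := leqP (#|K| ^ 2 * X) Y.
  by move: leXY; rewrite -subn_eq0 => /eqP ->.
rewrite -(ler_nat C) natrX.
apply: le_trans (_ : (3 * Q) ^+ 4 <= _).
  rewrite lerXn2r // ?nnegrE ?ler0n ?mulr_ge0 ?ler0n //.
  by rewrite natrB // natrM natrX YC lerBlDl.
rewrite exprMn; apply: le_trans (ler_wpM2l _ Q4) _; first by rewrite exprn_ge0 ?ler0n.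
by rewrite !(natrX, natrM) le_eqVlt; apply/orP; left; apply/eqP; ring.
Qed.

End Fourier.

Lemma distance_count_sum (K : finFieldType) (E F : {set 'rV[K]_2}) :
  (\sum_t distance_count E F t = #|E| * #|F|)%N.
Proof.
rewrite -cardsX -sum1_card (partition_big (fun p => norm2 (p.1 - p.2)) predT) //=.
apply: eq_bigr => t _; rewrite /distance_count -sum1_card.
by apply: eq_bigl => p; rewrite inE.
Qed.

Lemma distance_count_eq0 (K : finFieldType) (E F : {set 'rV[K]_2}) t :
  t \notin distance_set E F -> distance_count E F t = 0%N.
Proof.
move=> nt; apply/eqP; rewrite cards_eq0; apply: contraR nt => /set0Pn [[x y]].
rewrite !inE /= => /andP [/andP [xE yF] /eqP <-].
by apply/imset2P; exists x y.
Qed.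

(** * From the second moment to the number of distances *)

(** Here n0 and n1 count the pairs at zero and nonzero distance, X is the second moment
    and d the number of distances. If M < 16 q ^ 2 the hypothesis on M bounds q in
    terms of c, and d >= 1 suffices. Otherwise n0 <= M / 2 and, writing
    k = 1 + 729 / c ^ 3, the excess D is at most k q M ^ 2 (k ^ 4 >= k spares a
    fourth root), so that q X <= (4 + k) M ^ 2. *)
Lemma card_ge_of_second_moment (R : realFieldType) (c q M n0 n1 X D d : R) :
  0 < c -> 1 <= q -> 0 < M -> c ^+ 3 * q ^+ 8 <= M ^+ 3 ->
  0 <= n0 -> M = n0 + n1 -> n0 ^+ 2 <= 4 * q ^+ 2 * M ->
  1 <= d -> n1 ^+ 2 <= d * X ->
  q ^+ 2 * X <= 3 * q * M ^+ 2 + 3 * q ^+ 3 * M + D ->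
  0 <= D -> D ^+ 4 <= 729 * q ^+ 12 * M ^+ 5 ->
  (4 * (4 + (1 + 729 / c ^+ 3)) + 4096 / c ^+ 3)^-1 * q <= d.
Proof.
move=> c0 q1 M0 cM n00 Mn n0M d1 n1X XD D0 D4.
have c3 : 0 < c ^+ 3 by rewrite exprn_gt0.
set k := 1 + 729 / c ^+ 3; set h := 4096 / c ^+ 3.
have q0 : 0 < q by lra.
have k1 : 1 <= k by rewrite /k lerDl divr_ge0 // ltW.
have kc : 729 <= k * c ^+ 3 by rewrite /k mulrDl mul1r divfK ?gt_eqF // lerDr ltW.
have h0 : 0 < h by rewrite divr_gt0.
have den : 0 < 4 * (4 + k) + h by lra.
rewrite mulrC ler_pdivrMr //.
have [small|large] := ltP M (16 * q ^+ 2).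
  have : c ^+ 3 * q ^+ 8 < (16 * q ^+ 2) ^+ 3.
    by apply: le_lt_trans cM _; rewrite ltrXn2r // ?nnegrE ltW ?mulr_gt0 ?exprn_gt0.
  have -> : c ^+ 3 * q ^+ 8 = (c ^+ 3 * q ^+ 2) * q ^+ 6 by ring.
  have -> : (16 * q ^+ 2) ^+ 3 = 4096 * q ^+ 6 by ring.
  rewrite ltr_pM2r ?exprn_gt0 // mulrC -ltr_pdivlMr // -/h => qh.
  have : q <= q ^+ 2 by nra.
  have : 0 <= (d - 1) * (4 * (4 + k) + h) by rewrite mulr_ge0 ?subr_ge0 // ltW.
  lra.
have Dk : D <= k * q * M ^+ 2.
  rewrite -(@ler_pXn2r _ 4) ?nnegrE ?mulr_ge0 ?exprn_ge0 //; try lra.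
  apply: le_trans D4 _.
  have -> : (k * q * M ^+ 2) ^+ 4 = k ^+ 4 * (q ^+ 4 * M ^+ 5) * M ^+ 3 by ring.
  have w0 : 0 <= q ^+ 4 * M ^+ 5 by rewrite mulr_ge0 ?exprn_ge0 // ltW.
  apply: le_trans (_ : k * (q ^+ 4 * M ^+ 5) * (c ^+ 3 * q ^+ 8) <= _).
    have -> : 729 * q ^+ 12 * M ^+ 5 = 729 * (q ^+ 12 * M ^+ 5) by ring.
    have -> : k * (q ^+ 4 * M ^+ 5) * (c ^+ 3 * q ^+ 8) = k * c ^+ 3 * (q ^+ 12 * M ^+ 5).
      by ring.
    by rewrite ler_wpM2r // mulr_ge0 ?exprn_ge0 // ltW.
  apply: ler_pM => //; first by rewrite mulr_ge0 //; lra.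
    by rewrite mulr_ge0 ?exprn_ge0 // ltW.
  by rewrite ler_wpM2r // ler_eXnr.
have n0half : n0 <= M / 2.
  rewrite -(@ler_pXn2r _ 2) ?nnegrE //; last lra.
  by apply: le_trans n0M _; nra.
have n1half : (M / 2) ^+ 2 <= d * X.
  apply: le_trans n1X; rewrite lerXn2r // ?nnegrE; lra.
have qX : q * X <= (4 + k) * M ^+ 2.
  rewrite -(ler_pM2l q0); apply: le_trans (_ : q ^+ 2 * X <= _); first by rewrite mulrA.
  apply: le_trans XD _.
  have : 3 * q ^+ 3 * M <= q * M ^+ 2.
    have -> : 3 * q ^+ 3 * M = (q * M) * (3 * q ^+ 2) by ring.
    have -> : q * M ^+ 2 = (q * M) * M by ring.
    rewrite ler_wpM2l ?mulr_ge0 ?ltW //; have := exprn_gt0 2 q0; lra.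
  have -> : q * ((4 + k) * M ^+ 2) = 3 * q * M ^+ 2 + q * M ^+ 2 + k * q * M ^+ 2 by ring.
  lra.
have M2 : 0 < M ^+ 2 by rewrite exprn_gt0.
have main : q <= 4 * (4 + k) * d.
  rewrite -(ler_pM2r M2).
  have : q * (M / 2) ^+ 2 <= d * ((4 + k) * M ^+ 2).
    apply: le_trans (_ : d * (q * X) <= _); first by rewrite [d * _]mulrCA ler_pM2l.
    by rewrite ler_pM2l //; lra.
  have -> : q * (M / 2) ^+ 2 = q * M ^+ 2 / 4 by field.
  have -> : d * ((4 + k) * M ^+ 2) = (4 * (4 + k) * d * M ^+ 2) / 4 by field.
  lra.
apply: le_trans main _; rewrite mulrC ler_pM2l; lra.
Qed.

Lemma distance_count_bounds (K : finFieldType) (E F : {set 'rV[K]_2}) :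
  odd #|K| ->
  ((#|K| ^ 2 * \sum_(t : K | t != 0%R) distance_count E F t ^ 2
    - (3 * #|K| * (#|E| * #|F|) ^ 2 + 3 * #|K| ^ 3 * (#|E| * #|F|))) ^ 4
   <= 729 * #|K| ^ 12 * (#|E| * #|F|) ^ 5)%N /\
  (distance_count E F 0%R ^ 2 <= 4 * #|K| ^ 2 * (#|E| * #|F|))%N.
Proof.
move=> /natr2_neq0 two0.
have [chi [chiD norm_chi nontrivial]] := exists_additive_character K.
split; first exact: (@distance_count_moment algC K chi two0 chiD norm_chi nontrivial).
exact: (@distance_count_sqr_le algC K chi two0 chiD norm_chi nontrivial).
Qed.

Theorem theorem1p3 (R : realType) (c : R) (hc : 0 < c) :
  exists2 c' : R, 0 < c' &
    forall (K : finFieldType) (E F : {set 'rV[K]_2}),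
      odd #|K| ->
      c * #|K|%:R `^ (8 / 3) <= #|E|%:R * #|F|%:R ->
      c' * #|K|%:R <= #|distance_set E F|%:R.
Proof.
exists (4 * (4 + (1 + 729 / c ^+ 3)) + 4096 / c ^+ 3)^-1.
  have : 0 < (c ^+ 3)^-1 by rewrite invr_gt0 exprn_gt0.
  by move: (c ^+ 3)^-1 => i i0; rewrite invr_gt0; lra.
move=> K E F oddK large.
have [moment zero] := distance_count_bounds E F oddK.
set M := (#|E| * #|F|)%N in moment zero.
set X := (\sum_(t | _) _)%N in moment.
set n0 := distance_count E F 0 in zero.
set S := (3 * #|K| * M ^ 2 + 3 * #|K| ^ 3 * M)%N in moment.
have Msum : M = (\sum_t distance_count E F t)%N by rewrite distance_count_sum.
have Kgt0 : (0 < #|K|)%N by apply/card_gt0P; exists 0.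
have q0 : 0 < #|K|%:R :> R by rewrite ltr0n.
have MR : M%:R = #|E|%:R * #|F|%:R :> R by rewrite natrM.
have Mpos : 0 < M%:R :> R.
  by rewrite MR; apply: lt_le_trans large; rewrite mulr_gt0 ?powR_gt0.
apply: (@card_ge_of_second_moment _ c #|K|%:R M%:R n0%:R (M - n0)%:R X%:R
          ((#|K| ^ 2 * X - S)%N)%:R _ hc) => //.
- by rewrite ler1n.
- have -> : c ^+ 3 * #|K|%:R ^+ 8 = (c * #|K|%:R `^ (8 / 3)) ^+ 3.
    rewrite exprMn -(powR_mulrn 3 (powR_ge0 _ _)) -powRrM -(powR_mulrn 8 (ler0n _ _)).
    by congr (_ * _ `^ _); field.
  by rewrite MR lerXn2r // nnegrE !mulr_ge0 ?powR_ge0 ?ler0n // ltW.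
- by rewrite -natrD subnKC // Msum (bigD1 0) //= leq_addr.
- by rewrite -!natrX -!natrM ler_nat.
- have : (0 < M)%N by rewrite -(ltr0n R).
  rewrite muln_gt0 => /andP [/card_gt0P [x xE] /card_gt0P [y yF]].
  rewrite ler1n; apply/card_gt0P; exists (norm2 (x - y)).
  by apply/imset2P; exists x y.
(* Cauchy-Schwarz over the nonzero distances that occur. *)
- pose S' := [set t in distance_set E F | t != 0].
  have -> : (M - n0)%:R = \sum_(t in S') (distance_count E F t)%:R :> R.
    rewrite Msum (bigD1 0) //= addKn natr_sum.
    rewrite big_mkcond [RHS]big_mkcond; apply: eq_bigr => t _ /=.
    rewrite inE; case: (boolP (t \in distance_set E F)) => //= nt.
    by rewrite distance_count_eq0 // if_same.
  have := norm_sum_sqr_le (mem S') (fun t => (distance_count E F t)%:R : R).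
  rewrite ger0_norm ?sumr_ge0 // => /le_trans -> //.
  apply: ler_pM; rewrite ?ler0n //.
  - by apply: sumr_ge0 => t _; rewrite exprn_ge0.
  - by rewrite ler_nat subset_leq_card //; apply/subsetP => t; rewrite inE => /andP [].
  rewrite /X natr_sum big_mkcond [X in _ <= X]big_mkcond; apply: ler_sum => t _.
  rewrite inE natrX normr_nat; case: (t \in _); case: (t != 0) => //=.
  exact: sqr_ge0.
- have -> : 3 * #|K|%:R * M%:R ^+ 2 + 3 * #|K|%:R ^+ 3 * M%:R = S%:R :> R.
    by rewrite /S natrD !(natrX, natrM).
  by rewrite -natrX -natrM -natrD ler_nat -leq_subLR.
have <- : (729 * #|K| ^ 12 * M ^ 5)%:R = 729 * #|K|%:R ^+ 12 * M%:R ^+ 5 :> R.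
  by rewrite !(natrX, natrM).
by rewrite -natrX ler_nat.
Qed.
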